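(* Let $n\ge 2$ and $c\ge 2$. Let $a\in\mathbb{B}^n$ and let $f:\mathbb{B}^n\to\mathbb{B}^n=f(\mathbb{B}^n)$ be a Möbius transformation with $f(a)=0$. Then, for all $x,y\in\mathbb{B}^n$, $$\frac{1}{1+|a|}\,h_{\mathbb{B}^n,c}(x,y)\le h_{\mathbb{B}^n,c}(f(x),f(y))\le (1+|a|)\,h_{\mathbb{B}^n,c}(x,y),$$ and the constant $1+|a|$ is the best possible in both inequalities; that is, if $C>0$ satisfies $h_{\mathbb{B}^n,c}(f(x),f(y))\le C\,h_{\mathbb{B}^n,c}(x,y)$ for all $x,y\in\mathbb{B}^n$, then $C\ge 1+|a|$, and if $C>0$ satisfies $h_{\mathbb{B}^n,c}(f(x),f(y))\ge \frac1C\,h_{\mathbb{B}^n,c}(x,y)$ for all $x,y\in\mathbb{B}^n$, then $C\ge 1+|a|$.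
   Context: $\mathbb{R}^n$ carries the Euclidean norm $|\cdot|$, and $\mathbb{B}^n=\{x\in\mathbb{R}^n:|x|<1\}$ is the open unit ball. For a nonempty open set $D\subset\mathbb{R}^n$ with nonempty boundary $\partial D$ (taken in $\mathbb{R}^n$), let $d_D(x)=\inf_{z\in\partial D}|x-z|$ and, for $x,y\in D$, $$h_{D,c}(x,y)=\log\left(1+c\,\frac{|x-y|}{\sqrt{d_D(x)\,d_D(y)}}\right).$$ In particular $d_{\mathbb{B}^n}(x)=1-|x|$ for $x\in\mathbb{B}^n$. For $c\ge 2$, $h_{D,c}$ is a metric on $D$. A Möbius transformation of a domain onto another is the restriction to the domain of a Möbius transformation of $\overline{\mathbb{R}^n}=\mathbb{R}^n\cup\{\infty\}$ (a finite composition of reflections in hyperplanes and inversions in spheres; orientation-reversing maps are allowed). *)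

(* Defs.v *)
From HB Require Import structures.
From mathcomp Require Import all_boot all_order all_algebra.
From mathcomp Require Import all_classical all_reals all_analysis.
Import Order.TTheory GRing.Theory Num.Theory.
Import numFieldNormedType.Exports.

Set Implicit Arguments.
Unset Strict Implicit.
Unset Printing Implicit Defensive.

Local Open Scope classical_set_scope.
Local Open Scope ring_scope.

(* The library norm `|x| on 'rV[R]_n is the sup norm.  It induces the same
   topology (hence the same closures and interiors) as [enorm], but the metric
   notions below must use [enorm]. *)
Definition dotp (R : realType) (n : nat) (x y : 'rV[R]_n) : R :=
  \sum_(i < n) x ord0 i * y ord0 i.

Definition enorm (R : realType) (n : nat) (x : 'rV[R]_n) : R :=
  Num.sqrt (dotp x x).

Definition unit_ball (R : realType) (n : nat) : set 'rV[R]_n :=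
  [set x | enorm x < 1].

Definition boundary (T : topologicalType) (D : set T) : set T :=
  closure D `\` interior D.

Definition bdist (R : realType) (n : nat) (D : set 'rV[R]_n) (x : 'rV[R]_n) : R :=
  inf [set enorm (x - z) | z in boundary D].

Definition h_metric (R : realType) (n : nat) (D : set 'rV[R]_n) (c : R)
    (x y : 'rV[R]_n) : R :=
  ln (1 + c * (enorm (x - y) / Num.sqrt (bdist D x * bdist D y))).

(* In the one-point compactification, [Some x] is the finite point x and
   [None] is the point at infinity. *)
Notation Rbar R n := (one_point_compactification 'rV[R]_n).

(* Reflection in the hyperplane {x | dotp x v = t}, meaningful for v != 0. *)
Definition reflection (R : realType) (n : nat) (v : 'rV[R]_n) (t : R)
    (p : Rbar R n) : Rbar R n :=
  match p with
  | Some x => Some (x - (2 * (dotp x v - t) / dotp v v) *: v)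
  | None => None
  end.

(* Inversion in the sphere of centre b and radius r, meaningful for r > 0. *)
Definition inversion (R : realType) (n : nat) (b : 'rV[R]_n) (r : R)
    (p : Rbar R n) : Rbar R n :=
  match p with
  | Some x => if x == b then None
              else Some (b + (r ^+ 2 / enorm (x - b) ^+ 2) *: (x - b))
  | None => Some b
  end.

Inductive moebius (R : realType) (n : nat) : (Rbar R n -> Rbar R n) -> Prop :=
  | moebius_id : moebius id
  | moebius_reflection (v : 'rV[R]_n) (t : R) g :
      v != 0 -> moebius g -> moebius (reflection v t \o g)
  | moebius_inversion (b : 'rV[R]_n) (r : R) g :
      0 < r -> moebius g -> moebius (inversion b r \o g).

(* Only the values of f on D matter; the restriction of g to D must take finite
   values there, and its image must be all of D'. *)
Definition moebius_onto (R : realType) (n : nat) (D D' : set 'rV[R]_n)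
    (f : 'rV[R]_n -> 'rV[R]_n) : Prop :=
  (exists g : Rbar R n -> Rbar R n,
     moebius g /\ forall x, D x -> g (Some x) = Some (f x)) /\
  f @` D = D'.

(* Main.v *)
Require Import Defs.
From mathcomp Require Import all_boot all_order all_algebra.
From mathcomp Require Import all_classical all_reals all_analysis.
From mathcomp Require Import ring lra.
Import Order.TTheory GRing.Theory Num.Theory.
Import numFieldNormedType.Exports.
Local Open Scope classical_set_scope.
Local Open Scope ring_scope.

(* A Möbius transformation acts as a Lorentz transformation: with a conformal
   weight w > 0, it multiplies squared distances |p - q|^2 by w p * w q and pulls
   each form A |x|^2 + <b, x> + k back to w times such a form with the same
   discriminant |b|^2 - 4 A k.  If the unit ball is preserved, the form
   1 - |x|^2 is pulled back to a form positive exactly on the ball, so to a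
   multiple of itself, and the discriminant makes the multiple 1.  Hence
   |x - y|^2 / ((1 - |x|^2) (1 - |y|^2)) is invariant under f, so the ratio of the
   two arguments of the logarithms is
     sqrt ((1 + |f x|) (1 + |f y|) / ((1 + |x|) (1 + |y|))) <= 1 + |a|,
   as |f x| <= |x| + |a|; Bernoulli's inequality transfers this to the
   logarithms.  At x = 0 and y -> 0 the ratio tends to 1 + |a|.  The lower bound
   and its sharpness are the same facts for the inverse of f, which maps f 0 to 0,
   where |f 0| = |a|. *)

(** * Euclidean inner product and norm *)

Section EuclideanNorm.
Context {R : realType} {n : nat}.
Implicit Types (x y z : 'rV[R]_n) (k : R).

Lemma dotpC x y : dotp x y = dotp y x.
Proof. by apply: eq_bigr => i _; rewrite mulrC. Qed.

Lemma dotpDl x y z : dotp (x + y) z = dotp x z + dotp y z.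
Proof. by rewrite -big_split; apply: eq_bigr => i _; rewrite mxE mulrDl. Qed.

Lemma dotpZl k x y : dotp (k *: x) y = k * dotp x y.
Proof. by rewrite mulr_sumr; apply: eq_bigr => i _; rewrite mxE mulrA. Qed.

Lemma dotp0l x : dotp 0 x = 0.
Proof. by rewrite -(scale0r 0) dotpZl mul0r. Qed.

Lemma dotpNl x y : dotp (- x) y = - dotp x y.
Proof. by rewrite -scaleN1r dotpZl mulN1r. Qed.

Lemma dotpDr x y z : dotp z (x + y) = dotp z x + dotp z y.
Proof. by rewrite !(dotpC z) dotpDl. Qed.

Lemma dotpZr k x y : dotp y (k *: x) = k * dotp y x.
Proof. by rewrite !(dotpC y) dotpZl. Qed.

Lemma dotpNr x y : dotp y (- x) = - dotp y x.
Proof. by rewrite !(dotpC y) dotpNl. Qed.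

Definition dotpE := (dotpDl, dotpDr, dotpNl, dotpNr, dotpZl, dotpZr).

Lemma dotp_ge0 x : 0 <= dotp x x.
Proof. by apply: sumr_ge0 => i _; rewrite -expr2 sqr_ge0. Qed.

Lemma dotp_eq0 x : (dotp x x == 0) = (x == 0).
Proof.
apply/eqP/eqP => [|->]; last exact: dotp0l.
move/eqP; rewrite psumr_eq0 => [|i _]; last by rewrite -expr2 sqr_ge0.
move/allP => x0; apply/rowP => i; rewrite mxE.
by have := x0 i (mem_index_enum i); rewrite mulf_eq0 orbb => /eqP.
Qed.

Lemma enorm_ge0 x : 0 <= enorm x. Proof. exact: sqrtr_ge0. Qed.

Lemma sqr_enorm x : enorm x ^+ 2 = dotp x x.
Proof. by rewrite sqr_sqrtr // dotp_ge0. Qed.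

Lemma enorm_eq0 x : (enorm x == 0) = (x == 0).
Proof. by rewrite -dotp_eq0 -sqr_enorm sqrf_eq0. Qed.

Lemma enormZ k x : enorm (k *: x) = `|k| * enorm x.
Proof.
by rewrite /enorm dotpZl dotpZr mulrA -expr2 sqrtrM ?sqr_ge0 // sqrtr_sqr.
Qed.

Lemma enormN x : enorm (- x) = enorm x.
Proof. by rewrite -scaleN1r enormZ normrN1 mul1r. Qed.

Lemma enorm0 : enorm (0 : 'rV[R]_n) = 0.
Proof. by apply/eqP; rewrite enorm_eq0. Qed.

(** Cauchy-Schwarz, from the expansion of | |y| x - |x| y |^2 >= 0, whose left side is 2 |x| |y|
    (|x| |y| - <x, y>). *)
Lemma dotp_le x y : dotp x y <= enorm x * enorm y.
Proof.
have [->|x0] := eqVneq x 0.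
  by rewrite enorm0 mul0r dotp0l.
have [->|y0] := eqVneq y 0.
  by rewrite enorm0 mulr0 dotpC dotp0l.
have px : 0 < enorm x by rewrite lt_def enorm_eq0 x0 enorm_ge0.
have py : 0 < enorm y by rewrite lt_def enorm_eq0 y0 enorm_ge0.
have := dotp_ge0 (enorm y *: x - enorm x *: y).
rewrite !dotpE (dotpC y x) -!sqr_enorm => H.
have : 0 <= (enorm x * enorm y) * (enorm x * enorm y - dotp x y).
  by nra.
by rewrite pmulr_rge0 ?mulr_gt0 // subr_ge0.
Qed.

Lemma enormD x y : enorm (x + y) <= enorm x + enorm y.
Proof.
rewrite -(ler_pXn2r (ltn0Sn 1)) ?nnegrE ?addr_ge0 ?enorm_ge0 //.
rewrite sqr_enorm !dotpE (dotpC y x) -!sqr_enorm.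
have := dotp_le x y; nra.
Qed.

Lemma enorm_continuous : continuous (@enorm R n).
Proof.
move=> x; apply: (@continuous_comp _ _ _ (fun x => dotp x x) (@Num.sqrt R)).
  apply: (@continuous_big _ _ +%R 0 xpredT) => [|i _ y].
    by move=> ?; exact: add_continuous.
  by apply: continuousM; exact: coord_continuous.
exact: sqrt_continuous.
Qed.

End EuclideanNorm.

Lemma exists_unit_vector (R : realType) (n : nat) :
  (0 < n)%N -> exists e : 'rV[R]_n, enorm e = 1.
Proof.
case: n => // n _; exists (delta_mx ord0 ord0).
apply/eqP; rewrite -(eqrXn2 (ltn0Sn 1)) ?enorm_ge0 //.
rewrite sqr_enorm /dotp (bigD1 ord0) //= big1 => [|i i0].
  by rewrite !mxE !eqxx expr1n mulr1 addr0.
by rewrite !mxE (negPf i0) andbF mul0r.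
Qed.

(** * The unit ball and the distance to its boundary *)

Section UnitBall.
Context {R : realType} {n : nat}.
Implicit Types (x z : 'rV[R]_n).
Let B := @unit_ball R n.

Lemma open_unit_ball : open B.
Proof.
apply: (@open_comp _ _ (@enorm R n) [set t | t < 1]) => [x _|].
  exact: enorm_continuous.
exact: open_lt.
Qed.

Lemma boundary_unit_ball : boundary B = [set z | enorm z = 1].
Proof.
apply/seteqP; split => z /=; rewrite /boundary /=.
  rewrite (interior_id _).1; last exact: open_unit_ball.
  move=> [clz nz]; apply/eqP; rewrite eq_le; apply/andP; split.
    have cl : closed [set z : 'rV[R]_n | enorm z <= 1].
      apply: (@preimage_closed _ _ (@enorm R n) [set t | t <= 1]) => [x _|].
        exact: enorm_continuous.
      exact: closed_le.
    have : closure [set z : 'rV[R]_n | enorm z <= 1] z.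
      by apply: closureS clz => y /ltW.
    by rewrite -((closure_id _).1 cl).
  by rewrite leNgt; apply/negP.
move=> z1; split; last first.
  by move=> /interior_subset; rewrite /B/= /unit_ball /= z1 ltxx.
move=> U /= Uz.
have /(_ U) : t *: z @[t --> (1 : R)] --> 1 *: z.
  by apply: cvgZr_tmp; exact: cvg_id.
rewrite scale1r => /(_ Uz) /nbhs_ballP [e /= e0 eU].
(* Approach z radially from inside; the minimum with 1 keeps t positive. *)
pose t : R := 1 - Num.min 1 e / 2.
have m0 : 0 < Num.min 1 e by rewrite lt_min ltr01.
have m1 : Num.min 1 e <= 1 by rewrite ge_min lexx.
have me : Num.min 1 e <= e by rewrite ge_min lexx orbT.
exists (t *: z); split; last first.
  by apply: eU; rewrite /ball /= /t opprB addrC subrK ger0_norm; lra.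
by rewrite /B /unit_ball /= enormZ z1 mulr1 /t ger0_norm; lra.
Qed.

(** The triangle inequality gives the lower bound, attained at x / |x|, or at any unit vector if x =
    0. *)
Lemma bdist_unit_ball x : (0 < n)%N -> B x -> bdist B x = 1 - enorm x.
Proof.
move=> n0 Bx; rewrite /bdist boundary_unit_ball.
have lb : lbound [set enorm (x - z) | z in [set z | enorm z = 1]] (1 - enorm x).
  move=> _ [z /= z1 <-]; have := enormD x (- (x - z)).
  by rewrite enormN opprB addrC subrK z1 lerBlDl.
have [z [z1 xz]] : exists z, enorm z = 1 /\ enorm (x - z) = 1 - enorm x.
  have [->|x0] := eqVneq x 0.
    have [e e1] := exists_unit_vector R _ n0.
    by exists e; rewrite add0r enormN enorm0 subr0.
  have px : 0 < enorm x by rewrite lt_def enorm_eq0 x0 enorm_ge0.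
  exists ((enorm x)^-1 *: x); rewrite enormZ ger0_norm ?invr_ge0 ?ltW //.
  rewrite mulVf ?gt_eqF //; split=> //.
  rewrite -{1}[x]scale1r -scalerBl enormZ ler0_norm.
    by rewrite opprB mulrBl mulVf ?gt_eqF // mul1r.
  by rewrite subr_le0 invf_ge1 // ltW.
apply/eqP; rewrite eq_le -{1}xz; apply/andP; split.
  apply: ge_inf; first by exists (1 - enorm x).
  by exists z.
by apply: lb_le_inf lb; exists (enorm (x - z)), z.
Qed.

Lemma h_metric_unit_ball c x y : (0 < n)%N -> B x -> B y ->
  h_metric B c x y =
  ln (1 + c * (enorm (x - y) / Num.sqrt ((1 - enorm x) * (1 - enorm y)))).
Proof. by move=> n0 Bx By; rewrite /h_metric !bdist_unit_ball. Qed.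

End UnitBall.

(** * Möbius maps as Lorentz transformations *)

Section Moebius.
Context {R : realType} {n : nat}.
Implicit Types (p q : Rbar R n) (g : Rbar R n -> Rbar R n) (x y b : 'rV[R]_n).

(** Equations of spheres and, for A = 0, hyperplanes. The value at infinity is the limit after
    division by |x|^2. *)
Definition sphere_form (A : R) (b : 'rV[R]_n) (k : R) (p : Rbar R n) : R :=
  match p with
  | Some x => A * dotp x x + dotp b x + k
  | None => A
  end.

(* The values at infinity are limits of |x - y|^2 after dividing by |x|^2, resp.
   |y|^2, for each of the two points that tends to infinity. *)
Definition sqdist (p q : Rbar R n) : R :=
  match p, q with
  | Some x, Some y => dotp (x - y) (x - y)
  | None, None => 0
  | _, _ => 1
  end.

(** The discriminant is a quadratic form of signature (n + 1, 1) on the triples (A, b, k). The same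
    weight serves for distances and for forms. *)
Definition lorentzian g : Prop :=
  exists w : Rbar R n -> R,
    [/\ forall p, 0 < w p,
        forall p q, sqdist (g p) (g q) = w p * w q * sqdist p q
      & forall A b k, exists A' b' k',
          dotp b' b' - 4 * A' * k' = dotp b b - 4 * A * k /\
          forall p, sphere_form A b k (g p) = w p * sphere_form A' b' k' p].

Lemma lorentzian_comp g1 g2 :
  lorentzian g1 -> lorentzian g2 -> lorentzian (g1 \o g2).
Proof.
move=> [w1 [w1_gt0 d1 f1]] [w2 [w2_gt0 d2 f2]].
exists (fun p => w1 (g2 p) * w2 p); split => [p|p q|A b k].
- exact: mulr_gt0.
- by rewrite /= d1 d2; ring.
have [A1 [b1 [k1 [disc1 E1]]]] := f1 A b k.
have [A2 [b2 [k2 [disc2 E2]]]] := f2 A1 b1 k1.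
exists A2, b2, k2; split; first by rewrite disc2.
by move=> p; rewrite /= E1 E2 mulrA.
Qed.

Lemma lorentzian_reflection (v : 'rV[R]_n) (t : R) :
  v != 0 -> lorentzian (reflection v t).
Proof.
rewrite -dotp_eq0 => v0.
exists (fun=> 1); split => // [[x|] [y|]|A b k] /=; rewrite ?mulr1 ?mul1r //.
  rewrite !dotpE (dotpC v x) (dotpC v y) (dotpC y x).
  by field.
(* Substituting the reflected point changes the form by - m (<x, v> - t). *)
pose m := (4 * A * t + 2 * dotp b v) / dotp v v.
exists A, (b - m *: v), (k + m * t); split.
  rewrite !dotpE (dotpC v b) /m; by field.
move=> [x|] /=; rewrite mul1r // !dotpE (dotpC v x) /m; by field.
Qed.

Lemma lorentzian_inversion b (r : R) : 0 < r -> lorentzian (inversion b r).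
Proof.
move=> r0; have rN0 : r != 0 by rewrite gt_eqF.
have db x : x != b -> dotp (x - b) (x - b) != 0.
  by rewrite dotp_eq0 subr_eq0.
(* The values at b and at infinity are forced by the distance identity against a third point. *)
exists (fun p => match p with
         | Some x => if x == b then r ^- 2 else r ^+ 2 / dotp (x - b) (x - b)
         | None => r ^+ 2
         end); split.
- move=> [x|] /=; last by rewrite exprn_gt0.
  case: (eqVneq x b) => [_|xb]; first by rewrite invr_gt0 exprn_gt0.
  by rewrite divr_gt0 ?exprn_gt0 // lt_def db // dotp_ge0.
- have out x : x != b ->
      dotp (b + (r ^+ 2 / enorm (x - b) ^+ 2) *: (x - b) - b)
           (b + (r ^+ 2 / enorm (x - b) ^+ 2) *: (x - b) - b) =
      r ^+ 4 / dotp (x - b) (x - b).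
    move=> /db xb; rewrite addrC addKr sqr_enorm dotpZl dotpZr.
    by field.
  move=> [x|] [y|] /=.
  + case: (eqVneq x b) => [->|xb]; case: (eqVneq y b) => [->|yb] /=.
    * by rewrite subrr dotp0l mulr0.
    * rewrite -[b - y]opprB dotpNl dotpNr opprK.
      by have := db _ yb => ?; field; apply/andP.
    * by have := db _ xb => ?; field; apply/andP.
    * rewrite !sqr_enorm.
      have -> : x - y = (x - b) - (y - b) by rewrite opprB addrA subrK.
      rewrite opprD addrACA subrr add0r.
      move: (db _ xb) (db _ yb); move: (x - b) (y - b) => u v u0 v0.
      by rewrite !dotpE (dotpC v u); field; apply/andP.
  + case: (eqVneq x b) => [_|xb] /=; first by field.
    by rewrite out //; have := db _ xb => ?; field.
  + case: (eqVneq y b) => [_|yb] /=; first by field.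
    rewrite -[b - _]opprB dotpNl dotpNr opprK.
    by rewrite out //; have := db _ yb => ?; field.
  + by rewrite subrr dotp0l mulr0.
move=> A c k.
(* With u = x - b the form is A |u|^2 + <c0, u> + k0. Inversion turns it, up to the weight, into (k0
   / r^2) |u|^2 + <c0, u> + A r^2, which is then expanded in x. *)
pose c0 := (2 * A) *: b + c; pose k0 := sphere_form A c k (Some b).
exists (k0 / r ^+ 2), (c0 - (2 * (k0 / r ^+ 2)) *: b),
  (k0 / r ^+ 2 * dotp b b - dotp c0 b + A * r ^+ 2).
split; first by rewrite /c0 /k0 /= !dotpE ?(dotpC b c); field.
move=> [x|] /=; last by rewrite /k0 /=; field.
case: (eqVneq x b) => [->|xb] /=.
  by rewrite /c0 /k0 /= !dotpE ?(dotpC b c); field.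
rewrite sqr_enorm; move: (db _ xb).
have -> : dotp x x = dotp (x - b) (x - b) + 2 * dotp (x - b) b + dotp b b.
  by rewrite !dotpE (dotpC b x); ring.
have e z : dotp z x = dotp z (x - b) + dotp z b by rewrite -dotpDr subrK.
rewrite e; move: (x - b) => u u0.
rewrite /c0 /k0 /= !dotpE ?(dotpC b u) ?(dotpC b c) ?(dotpC u c).
by field; apply/andP.
Qed.

Lemma lorentzian_moebius g : moebius g -> lorentzian g.
Proof.
elim=> [|v t {}g v0 _ IH|b r {}g r0 _ IH].
- exists (fun=> 1); split => // [p q|A b k]; first by rewrite !mul1r.
  by exists A, b, k; split=> // p; rewrite mul1r.
- by apply: lorentzian_comp => //; exact: lorentzian_reflection.
- by apply: lorentzian_comp => //; exact: lorentzian_inversion.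
Qed.

Lemma sqdist_eq0 p q : (sqdist p q == 0) = (p == q).
Proof.
case: p q => [x|] [y|] /=; rewrite ?oner_eq0 ?eqxx //.
by rewrite dotp_eq0 subr_eq0.
Qed.

Lemma lorentzian_inj g : lorentzian g -> injective g.
Proof.
move=> [w [w0 d _]] p q /eqP; rewrite -sqdist_eq0 d.
rewrite !mulf_eq0 !(gt_eqF (w0 _)) !orFb.
by rewrite sqdist_eq0 => /eqP.
Qed.

End Moebius.

(** * Inequalities and a limit for logarithms *)

Section Logarithm.
Context {R : realType}.
Implicit Types k u : R.

(** Concavity of ln at 1 + u = (1/k) (1 + k u) + (1 - 1/k) 1. *)
Lemma ln_bernoulli k u : 1 <= k -> 0 <= u -> ln (1 + k * u) <= k * ln (1 + u).
Proof.
move=> k1 u0; have k0 : 0 < k by lra.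
have ik0 : 0 <= k^-1 by rewrite invr_ge0 ltW.
have ik1 : k^-1 <= 1 by rewrite invf_le1.
have ku : 0 < 1 + k * u by nra.
have := @concave_ln _ (Itv01 ik0 ik1) _ _ ku ltr01.
rewrite !convRE /= /unstable.onem ln1 mulr0 addr0 mulr1.
rewrite mulrDr mulr1 mulrA mulVf ?gt_eqF // mul1r.
rewrite addrAC addrC [k^-1 + _]addrC subrK.
by rewrite addrC ler_pdivrMl.
Qed.

(** This is ln (1 + v) <= v at v = - u / (1 + u), where 1 + v = 1 / (1 + u). *)
Lemma ln1D_ge u : 0 <= u -> u / (1 + u) <= ln (1 + u).
Proof.
move=> u0; have p : 0 < 1 + u by lra.
have v : 1 + - (u / (1 + u)) = (1 + u)^-1 by field; rewrite gt_eqF.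
rewrite -lerN2 -lnV ?posrE // -[in leLHS]v le_ln1Dx //.
by rewrite ltrN2 ltr_pdivrMr // mul1r ltrDr ltr01.
Qed.

Lemma le_of_affine_perturbation (u v M e : R) : 0 < e ->
  (forall s, 0 < s -> s <= e -> u <= v + s * M) -> u <= v.
Proof.
move=> e0 H; rewrite leNgt; apply/negP => vu.
have M1 : 0 < `|M| + 1 by rewrite ltr_wpDl.
pose s := Num.min e ((u - v) / (2 * (`|M| + 1))).
have d0 : 0 < (u - v) / (2 * (`|M| + 1)).
  by rewrite divr_gt0 ?mulr_gt0 ?subr_gt0.
have s0 : 0 < s by rewrite lt_min e0.
have := H s s0; rewrite ge_min lexx => /(_ isT).
have : s * (2 * (`|M| + 1)) <= u - v.
  by rewrite -ler_pdivlMr ?mulr_gt0 // ge_min lexx orbT.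
have := ler_norm M; nra.
Qed.

(* First-order expansion at s = 0: both logarithms are equivalent to their
   arguments, so the limiting ratio is that of k s to 1. *)
Lemma ln_ratio_limit (c C r : R) (k : R -> R) : 0 < c -> 0 < C -> 0 <= r ->
  (forall s, 0 < s -> s <= 1 / 2 ->
     [/\ 0 <= k s, k s <= 1 + r,
         (1 + r) * (1 + r - s) <= (1 + s) * k s ^+ 2 &
         ln (1 + c * (k s * (s / Num.sqrt (1 - s)))) <=
           C * ln (1 + c * (s / Num.sqrt (1 - s)))]) ->
  1 + r <= C.
Proof.
move=> c0 C0 r0 H.
(* For s <= 1/2, [M] bounds the growth in s of the final estimate s + (1 + s) C (1 + 2 c (1 + r) s),
   whose value at 0 is C. *)
pose M := 1 + C * (6 * c * (1 + r) + 1).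
apply: (@le_of_affine_perturbation _ _ M (1 / 2)); first lra.
move=> s s0 s1; rewrite /M.
have [k0 k1 k2 k3] := H s s0 s1.
have q0 : 0 < Num.sqrt (1 - s) by rewrite sqrtr_gt0; lra.
have q1 : Num.sqrt (1 - s) ^+ 2 = 1 - s by rewrite sqr_sqrtr; lra.
have q2 : 1 / 2 <= Num.sqrt (1 - s) by nra.
set T := s / _ in k3.
have T0 : 0 < T by rewrite divr_gt0.
have T1 : T <= 2 * s by rewrite ler_pdivrMr //; nra.
have cT : 0 < c * T by rewrite mulr_gt0.
have cKT : 0 <= c * (k s * T) by rewrite !mulr_ge0 // ltW.
have le1 : c * (k s * T) / (1 + c * (k s * T)) <= C * (c * T).
  apply: le_trans (ln1D_ge _ cKT) _; apply: le_trans k3 _.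
  by rewrite ler_pM2l // le_ln1Dx //; lra.
have le2 : k s <= C * (1 + c * (k s * T)).
  rewrite -(ler_pM2l cT); move: le1; rewrite ler_pdivrMr; last lra.
  by move=> H1; lra.
have le3 : k s <= C * (1 + c * ((1 + r) * (2 * s))).
  apply: le_trans le2 _; rewrite ler_pM2l // lerD2l ler_pM2l //.
  by rewrite ler_pM // ltW.
(* As k s <= 1 + r, the quadratic hypothesis becomes linear after cancelling 1 + r. *)
have le4 : 1 + r - s <= (1 + s) * k s.
  rewrite -(@ler_pM2l _ (1 + r)); last lra.
  apply: le_trans k2 _; have : 0 <= (1 + s) * (k s * (1 + r - k s)).
    by rewrite !mulr_ge0 //; lra.
  lra.
apply: (@le_trans _ _ (s + (1 + s) * (C * (1 + c * ((1 + r) * (2 * s)))))).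
  rewrite -lerBlDl; apply: le_trans le4 _; rewrite ler_pM2l //; lra.
have : 0 <= s * (C * (c * (1 + r))) * (4 - 2 * s) by rewrite !mulr_ge0 //; lra.
lra.
Qed.

End Logarithm.

(** * Hyperbolic isometries of the ball *)

Section HyperbolicIsometry.
Context {R : realType} {n : nat}.
Hypothesis n_gt0 : (0 < n)%N.
Implicit Types (f g : 'rV[R]_n -> 'rV[R]_n) (a b x y : 'rV[R]_n).
Let B := @unit_ball R n.

(** By radial limits the form vanishes on the unit sphere; comparing e with - e separates <b, e> = 0
    from A + k = 0, and e = b / |b| would contradict b != 0. *)
Lemma sphere_form_vanishing (A : R) b (k : R) :
  (forall x, enorm x < 1 -> 0 < sphere_form A b k (Some x)) ->
  (forall x, enorm x = 1 -> sphere_form A b k (Some x) <= 0) ->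
  b = 0 /\ A = - k.
Proof.
move=> pos neg.
have S0 e : enorm e = 1 -> dotp b e = - (A + k).
  move=> e1; have ee : dotp e e = 1 by rewrite -sqr_enorm e1 expr1n.
  have : sphere_form A b k (Some e) <= 0 by exact: neg.
  rewrite /= ee mulr1 => le0.
  have ge0 : 0 <= A + dotp b e + k.
    (* The slope comes from expanding the form at (1 - s) e and bounding s^2 A by s |A|. *)
    apply: (@le_of_affine_perturbation _ _ _ (`|A| - 2 * A - dotp b e) 1) => //.
    move=> s s0 s1.
    have := pos ((1 - s) *: e).
    rewrite enormZ e1 mulr1 ger0_norm ?subr_ge0 // ltrBlDr ltrDl => /(_ s0).
    rewrite /= !dotpE ee mulr1.
    have : 0 <= s * (s * (`|A| - A)).
      by rewrite !mulr_ge0 ?subr_ge0 ?ler_norm // ltW.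
    have : 0 <= s * (1 - s) * `|A| by rewrite !mulr_ge0 ?subr_ge0 // ltW.
    lra.
  lra.
have bE e : enorm e = 1 -> dotp b e = 0 /\ A = - k.
  move=> e1; have := S0 _ e1; have := S0 (- e).
  rewrite enormN dotpNr => /(_ e1) ? ?; split; lra.
have [e e1] := exists_unit_vector R _ n_gt0.
split; last exact: (bE _ e1).2.
apply/eqP; rewrite -enorm_eq0; apply/negPn/negP => b0.
have bp : 0 < enorm b by rewrite lt_def b0 enorm_ge0.
have := bE ((enorm b)^-1 *: b).
rewrite enormZ ger0_norm ?invr_ge0 ?ltW // mulVf // => /(_ erefl) [+ _].
by rewrite dotpZr -sqr_enorm expr2 mulKf // => /eqP; rewrite (negPf b0).
Qed.

(** Cross-multiplied invariance of |x - y|^2 / ((1 - |x|^2) (1 - |y|^2)), which is sinh^2 of half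
    the hyperbolic distance in curvature -1. *)
Definition hyperbolic_isometry f : Prop :=
  (forall x, B x -> B (f x)) /\
  forall x y, B x -> B y ->
    enorm (f x - f y) ^+ 2 * ((1 - enorm x ^+ 2) * (1 - enorm y ^+ 2)) =
    enorm (x - y) ^+ 2 * ((1 - enorm (f x) ^+ 2) * (1 - enorm (f y) ^+ 2)).

Lemma moebius_onto_hyperbolic_isometry f :
  moebius_onto B B f -> hyperbolic_isometry f.
Proof.
move=> [[g [mg gf]] fB].
have fBB x : B x -> B (f x) by move=> Bx; rewrite -fB; exists x.
have ginj := lorentzian_inj _ (lorentzian_moebius _ mg).
have [w [w0 d form]] := lorentzian_moebius _ mg.
have [A [b [k [disc E]]]] := form (-1) 0 1.
have posE p : (0 < sphere_form A b k p) = (0 < sphere_form (-1) 0 1 (g p)).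
  by rewrite E pmulr_rgt0.
have BE x : B x <-> 0 < sphere_form (-1) 0 1 (Some x).
  rewrite /B /unit_ball /= dotp0l addr0 mulN1r addrC subr_gt0 -sqr_enorm.
  by rewrite expr_lt1 // enorm_ge0.
have [b0 Ak] : b = 0 /\ A = - k.
  apply: sphere_form_vanishing => x x1.
    by rewrite posE gf //; exact/BE/fBB.
  (* If a point of the unit sphere were sent into the ball, surjectivity would give its image a
     second preimage inside the ball, against injectivity. At infinity the form is -1. *)
  rewrite leNgt posE; apply/negP; case Ex : (g (Some x)) => [u|]; last first.
    by rewrite /= ltr0N1.
  move=> /BE; rewrite -fB => -[y By yu].
  have : g (Some y) = g (Some x) by rewrite Ex gf // yu.
  by move=> /ginj [] yx; move: By; rewrite yx /B /unit_ball /= x1 ltxx.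
have k0 : 0 < k.
  have B0 : B 0 by rewrite /B /unit_ball /= enorm0.
  have := (BE _).1 (fBB _ B0).
  by rewrite -gf // -posE /= !(dotpC _ 0) !dotp0l; lra.
(* Equality of the discriminants reads 4 k^2 = 4. *)
have k1 : k = 1.
  move: disc; rewrite b0 Ak !dotp0l => kk.
  have : (k - 1) * (k + 1) = 0 by lra.
  by move=> /eqP; rewrite mulf_eq0 => /orP[] /eqP; lra.
have norm x : B x -> 1 - enorm (f x) ^+ 2 = w (Some x) * (1 - enorm x ^+ 2).
  move=> Bx; have := E (Some x); rewrite gf //= b0 Ak k1 !dotp0l !sqr_enorm.
  lra.
split=> // x y Bx By; have := d (Some x) (Some y).
by rewrite !gf //= !norm // !sqr_enorm => ->; ring.
Qed.

Lemma hyperbolic_isometry_inj f x y :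
  hyperbolic_isometry f -> B x -> B y -> f x = f y -> x = y.
Proof.
move=> [fB H] Bx By fxy; have := H x y Bx By.
rewrite fxy subrr enorm0 expr0n /= mul0r => /esym /eqP.
have lt1 z : B z -> 1 - enorm z ^+ 2 != 0.
  by move=> Bz; rewrite gt_eqF // subr_gt0 expr_lt1 ?enorm_ge0.
rewrite mulf_eq0 expf_eq0 enorm_eq0 subr_eq0 => /orP[/eqP //|].
by rewrite mulf_eq0 (negPf (lt1 _ (fB _ By))).
Qed.

(** The defining identity is symmetric under exchanging points with their images, so any choice of
    preimages satisfies it. *)
Lemma hyperbolic_isometry_inverse f :
  hyperbolic_isometry f -> f @` B = B ->
  exists g, hyperbolic_isometry g /\ forall x, B x -> g (f x) = x /\ f (g x) = x.
Proof.
move=> hf fB.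
have : forall u, exists x, B u -> B x /\ f x = u.
  move=> u; have [Bu|nBu] := pselect (B u); last by exists 0.
  have [x Bx xu] : (f @` B) u by rewrite fB.
  by exists x.
move=> /choice [g gP]; exists g; split; last first.
  move=> x Bx; split; last exact: (gP _ Bx).2.
  have [Bg Eg] := gP _ (hf.1 _ Bx).
  exact: (hyperbolic_isometry_inj _ _ _ hf Bg Bx Eg).
split=> [u /gP []//|u v Bu Bv].
have [Bg gu] := gP _ Bu; have [Bh gv] := gP _ Bv.
by have := hf.2 _ _ Bg Bh; rewrite gu gv.
Qed.

(** * Bounds on the norm of an image point *)

Section NormBounds.
Variables (f : 'rV[R]_n -> 'rV[R]_n) (a : 'rV[R]_n).
Hypotheses (hf : hyperbolic_isometry f) (Ba : B a) (fa : f a = 0).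

Let norm_identity x : B x ->
  enorm (f x) ^+ 2 * ((1 - enorm x ^+ 2) * (1 - enorm a ^+ 2)) =
  enorm (x - a) ^+ 2 * (1 - enorm (f x) ^+ 2).
Proof.
by move=> Bx; have := hf.2 x a Bx Ba; rewrite fa subr0 enorm0 expr0n subr0 mulr1.
Qed.

(* The identity above says |f x| = d / sqrt (d^2 + (1 - |x|^2) (1 - |a|^2)) with
   d = |x - a|, and this is increasing in d; d = |x| + |a| and d = |a| - |x|
   give (|x| + |a|) / (1 + |x| |a|) and (|a| - |x|) / (1 - |x| |a|). *)
Lemma enorm_hyperbolic_isometry_le x : B x -> enorm (f x) <= enorm x + enorm a.
Proof.
move=> Bx; have := norm_identity _ Bx; have := hf.1 _ Bx.
move: Bx Ba; rewrite /B /unit_ball /=.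
have := enormD x (- a); rewrite enormN.
move: (enorm_ge0 (f x)) (enorm_ge0 x) (enorm_ge0 a) (enorm_ge0 (x - a)).
move: (enorm (f x)) (enorm x) (enorm a) (enorm (x - a)) => F X r d.
move=> F0 X0 r0 d0 dle X1 r1 F1 E.
have dd : d ^+ 2 <= (X + r) ^+ 2 by rewrite ler_pXn2r ?nnegrE ?addr_ge0.
have F2 : 0 <= 1 - F ^+ 2 by rewrite subr_ge0 expr_le1 // ltW.
(* By (1 - X^2) (1 - r^2) + (X + r)^2 = (1 + X r)^2. *)
have : (F * (1 + X * r)) ^+ 2 <= (X + r) ^+ 2.
  have := ler_wpM2r F2 dd; rewrite -E; nra.
have Xr : 0 <= X * r by rewrite mulr_ge0.
rewrite ler_pXn2r ?nnegrE ?mulr_ge0 ?addr_ge0 // => /(le_trans _); apply.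
by rewrite mulrDr mulr1 lerDl mulr_ge0.
Qed.

Lemma enorm_hyperbolic_isometry_ge x : B x -> enorm a - enorm x <= enorm (f x).
Proof.
move=> Bx; have := norm_identity _ Bx; have := hf.1 _ Bx.
move: Bx Ba; rewrite /B /unit_ball /=.
have := enormD x (- (x - a)); rewrite enormN opprB addrC subrK.
move: (enorm_ge0 (f x)) (enorm_ge0 x) (enorm_ge0 a) (enorm_ge0 (x - a)).
move: (enorm (f x)) (enorm x) (enorm a) (enorm (x - a)) => F X r d.
move=> F0 X0 r0 d0 dge X1 r1 F1 E.
have [rX|Xr] := leP r X; first by rewrite (le_trans _ F0) // subr_le0.
have rX0 : 0 <= r - X by rewrite subr_ge0 ltW.
have dd : (r - X) ^+ 2 <= d ^+ 2 by rewrite ler_pXn2r ?nnegrE // lerBlDl.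
have F2 : 0 <= 1 - F ^+ 2 by rewrite subr_ge0 expr_le1 // ltW.
have : (r - X) ^+ 2 <= (F * (1 - X * r)) ^+ 2.
  have := ler_wpM2r F2 dd; rewrite -E; nra.
have Xr0 : 0 <= X * r by rewrite mulr_ge0.
have Xr1 : 0 <= 1 - X * r by rewrite subr_ge0 mulr_ile1 // ltW.
rewrite ler_pXn2r ?nnegrE ?mulr_ge0 // => /le_trans; apply.
by rewrite mulrBr mulr1 gerBl mulr_ge0.
Qed.

Lemma enorm_hyperbolic_isometry0 : enorm (f 0) = enorm a.
Proof.
have B0 : B 0 by rewrite /B /unit_ball /= enorm0.
apply/eqP; rewrite eq_le.
have := enorm_hyperbolic_isometry_le _ B0; rewrite enorm0 add0r => ->.
by have := enorm_hyperbolic_isometry_ge _ B0; rewrite enorm0 subr0 => ->.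
Qed.

End NormBounds.

(** * Distortion of the metric [h_metric] *)

Definition distortion f x y : R :=
  Num.sqrt ((1 + enorm (f x)) * (1 + enorm (f y)) /
            ((1 + enorm x) * (1 + enorm y))).

Lemma sqr_distortion f x y : distortion f x y ^+ 2 =
  (1 + enorm (f x)) * (1 + enorm (f y)) / ((1 + enorm x) * (1 + enorm y)).
Proof. by rewrite sqr_sqrtr // divr_ge0 // mulr_ge0 // addr_ge0 // enorm_ge0. Qed.

(** Writing 1 - |z| as (1 - |z|^2) / (1 + |z|), the isometry identity cancels the numerators and
    leaves [distortion]. *)
Lemma h_metric_hyperbolic_isometry f c x y :
  hyperbolic_isometry f -> B x -> B y ->
  h_metric B c (f x) (f y) =
  ln (1 + c * (distortion f x y *
     (enorm (x - y) / Num.sqrt ((1 - enorm x) * (1 - enorm y))))).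
Proof.
move=> [fB H] Bx By; rewrite h_metric_unit_ball //; [|exact: fB|exact: fB].
congr (ln (1 + c * _)); apply/eqP.
rewrite -(eqrXn2 (ltn0Sn 1)) ?mulr_ge0 ?divr_ge0 ?sqrtr_ge0 ?enorm_ge0 //.
have B1 z : B z -> 0 < 1 - enorm z by move=> Bz; rewrite subr_gt0.
have P1 (z : 'rV[R]_n) : 0 < 1 + enorm z by rewrite ltr_wpDr ?enorm_ge0.
have P z z' : B z -> B z' -> 0 <= (1 - enorm z) * (1 - enorm z').
  by move=> ? ?; rewrite mulr_ge0 // ltW // B1.
have Bfx := fB _ Bx; have Bfy := fB _ By.
rewrite !exprMn !exprVn sqr_distortion !sqr_sqrtr ?P ?dotp_ge0 // -!sqr_enorm.
move: (H x y Bx By) (B1 _ Bx) (B1 _ By) (B1 _ (fB _ Bx)) (B1 _ (fB _ By)).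
move: (P1 x) (P1 y) (P1 (f x)) (P1 (f y)).
move: (enorm (f x - f y)) (enorm (x - y)).
move: (enorm x) (enorm y) (enorm (f x)) (enorm (f y)).
move=> X Y F G D d pX pY pF pG E mX mY mF mG.
have -> : D ^+ 2 = d ^+ 2 * ((1 - F ^+ 2) * (1 - G ^+ 2)) /
                    ((1 - X ^+ 2) * (1 - Y ^+ 2)).
  by rewrite -E mulfK // gt_eqF // mulr_gt0 //; nra.
apply/eqP; field; rewrite !gt_eqF //=; nra.
Qed.

Section Distortion.
Variables (f : 'rV[R]_n -> 'rV[R]_n) (a : 'rV[R]_n) (c : R).
Hypotheses (hf : hyperbolic_isometry f) (Ba : B a) (fa : f a = 0) (c_gt0 : 0 < c).

(** Each factor satisfies 1 + |f z| <= 1 + |z| + |a| <= (1 + |a|) (1 + |z|). *)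
Lemma distortion_le x y : B x -> B y -> distortion f x y <= 1 + enorm a.
Proof.
move=> Bx By; rewrite -[leRHS]ger0_norm; last by rewrite addr_ge0 ?enorm_ge0.
rewrite -sqrtr_sqr ler_wsqrtr // ler_pdivrMr; last first.
  by rewrite mulr_gt0 // ltr_wpDr ?enorm_ge0.
have le z : B z -> 0 <= 1 + enorm (f z) <= (1 + enorm a) * (1 + enorm z).
  move=> Bz; rewrite addr_ge0 ?enorm_ge0 //=.
  have := enorm_hyperbolic_isometry_le _ _ hf Ba fa _ Bz.
  have := mulr_ge0 (enorm_ge0 a) (enorm_ge0 z); lra.
rewrite expr2 mulrACA; have /andP [? ?] := le _ Bx; have /andP [? ?] := le _ By.
exact: ler_pM.
Qed.

Lemma h_metric_distortion x y : B x -> B y ->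
  h_metric B c (f x) (f y) <= (1 + enorm a) * h_metric B c x y.
Proof.
move=> Bx By; rewrite h_metric_hyperbolic_isometry // h_metric_unit_ball //.
have T0 : 0 <= enorm (x - y) / Num.sqrt ((1 - enorm x) * (1 - enorm y)).
  by rewrite divr_ge0 ?sqrtr_ge0 ?enorm_ge0.
have K0 : 0 <= distortion f x y by exact: sqrtr_ge0.
have K1 := distortion_le _ _ Bx By.
apply: le_trans (ln_bernoulli _ _ _ _).
- rewrite ler_ln ?posrE ?ltr_wpDr ?mulr_ge0 ?addr_ge0 ?enorm_ge0 ?(ltW c_gt0) //.
  by rewrite lerD2l mulrCA ler_wpM2r // mulr_ge0 // ltW.
- by rewrite lerDl enorm_ge0.
- by rewrite mulr_ge0 // ltW.
Qed.

Lemma h_metric_distortion_sharp (C : R) : 0 < C ->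
  (forall x y, B x -> B y ->
     h_metric B c (f x) (f y) <= C * h_metric B c x y) ->
  1 + enorm a <= C.
Proof.
move=> C0 H; have [e e1] := exists_unit_vector R _ n_gt0.
have B0 : B 0 by rewrite /B /unit_ball /= enorm0.
(* Any direction e serves: |f 0| = |a| and |f (s e)| >= |a| - s bound the distortion from below. *)
apply: (@ln_ratio_limit _ c C _ (fun s => distortion f 0 (s *: e))) => //.
  exact: enorm_ge0.
move=> s s0 s1.
have es : enorm (s *: e) = s by rewrite enormZ e1 mulr1 gtr0_norm.
have Bs : B (s *: e) by rewrite /B /unit_ball /= es; lra.
split; [exact: sqrtr_ge0|exact: distortion_le| |].
  rewrite sqr_distortion (enorm_hyperbolic_isometry0 _ _ hf Ba fa).
  rewrite enorm0 addr0 mul1r es mulrC.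
  rewrite [leRHS]mulrC divfK; last by rewrite gt_eqF //; lra.
  rewrite mulrC ler_wpM2l ?addr_ge0 ?enorm_ge0 //.
  by rewrite -addrA lerD2l -{1}es (enorm_hyperbolic_isometry_ge _ _ hf Ba fa).
have := H _ _ B0 Bs; rewrite h_metric_hyperbolic_isometry // h_metric_unit_ball //.
by rewrite sub0r enormN enorm0 subr0 mul1r es.
Qed.

End Distortion.

End HyperbolicIsometry.

Theorem theorem1p1 (R : realType) (n : nat) (c : R) (a : 'rV[R]_n)
    (f : 'rV[R]_n -> 'rV[R]_n) :
  (2 <= n)%N -> 2 <= c ->
  let B := @unit_ball R n in
  let h := h_metric B c in
  B a -> moebius_onto B B f -> f a = 0 ->
  [/\ (forall x y, B x -> B y ->
         1 / (1 + enorm a) * h x y <= h (f x) (f y) /\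
         h (f x) (f y) <= (1 + enorm a) * h x y),
      (forall C : R, 0 < C ->
         (forall x y, B x -> B y -> h (f x) (f y) <= C * h x y) ->
         1 + enorm a <= C)
    & (forall C : R, 0 < C ->
         (forall x y, B x -> B y -> 1 / C * h x y <= h (f x) (f y)) ->
         1 + enorm a <= C)].
Proof.
move=> n2 c2 B h Ba mf fa.
have n0 : (0 < n)%N by exact: ltnW.
have c0 : 0 < c by lra.
have hf := moebius_onto_hyperbolic_isometry n0 _ mf.
have [g [hg gK]] := hyperbolic_isometry_inverse _ hf mf.2.
have B0 : B 0 by rewrite /B /unit_ball /= enorm0.
have gf0 : g (f 0) = 0 by exact: (gK 0 B0).1.
have Bf0 : B (f 0) by exact: hf.1.
have f0 : enorm (f 0) = enorm a by exact: (enorm_hyperbolic_isometry0 _ _ hf Ba fa).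
split.
- move=> x y Bx By; split; last exact: (h_metric_distortion n0 _ _ _ hf).
  (* The upper bound for the inverse [g] has constant 1 + |f 0|, as [g] sends [f 0] to 0; hence |a|
     is rewritten as |f 0|. *)
  rewrite div1r ler_pdivrMl ?ltr_wpDr ?enorm_ge0 // -f0.
  have := h_metric_distortion n0 g _ c hg Bf0 gf0 c0 _ _ (hf.1 _ Bx) (hf.1 _ By).
  by rewrite (gK _ Bx).1 (gK _ By).1.
- by move=> C C0; exact: (h_metric_distortion_sharp n0 _ _ _ hf).
- move=> C C0 H; rewrite -f0.
  apply: (h_metric_distortion_sharp n0 g _ c hg Bf0 gf0 c0) => //.
  (* At the points [g u] and [g v] the assumed lower bound for f is an upper bound for [g]. *)
  move=> u v Bu Bv; have := H _ _ (hg.1 _ Bu) (hg.1 _ Bv).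
  by rewrite (gK _ Bu).2 (gK _ Bv).2 div1r ler_pdivrMl.
Qed.
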